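(* Consider the SBP-SAT semi-discretization described in the context, with $\Sigma^{(3)}_{\gamma\kappa}=-\Sigma^{(2)}_{\gamma\kappa}=\tfrac12B_\gamma$ and $\Sigma^{(4)}_{\gamma\kappa}=0$ for every element $\kappa$ and every interior face $\gamma$ of $\kappa$. Let $\alpha_{\gamma\kappa}\ge0$ be weights, one for each face $\gamma$ of each element $\kappa$, with $\sum_{\gamma\subset\Gamma_\kappa}\alpha_{\gamma\kappa}=1$ for every $\kappa$ and $\alpha_{\gamma\kappa}>0$ on all interior and Dirichlet faces. Let $(\lambda_{\max})_\kappa$ denote the largest eigenvalue of $\begin{bmatrix}\Lambda_{xx}&\Lambda_{xy}\\ \Lambda_{yx}&\Lambda_{yy}\end{bmatrix}_\kappa$ and $\|\cdot\|_2$ the matrix 2-norm. Suppose that on every interior face $\gamma$, shared by elements $\kappa$ and $\nu$, $\Sigma^{(1)}_{\gamma\kappa}=\Sigma^{(1)}_{\gamma\nu}=\delta^{(1)}_\gamma B_\gamma$, and on every Dirichlet face $\gamma$ (a face of element $\kappa$) $\Sigma^{\mathcal D}_\gamma=\delta^{\mathcal D}_\gamma B_\gamma$, where $$\delta^{(1)}_\gamma=\frac{(\lambda_{\max})_\kappa\,\|B_\gamma^{1/2}R_{\gamma\kappa}H_\kappa^{-1/2}\|_2^2}{4\,\alpha_{\gamma\kappa}}+\frac{(\lambda_{\max})_\nu\,\|B_\gamma^{1/2}R_{\gamma\nu}H_\nu^{-1/2}\|_2^2}{4\,\alpha_{\gamma\nu}},\qquad \delta^{\mathcal D}_\gamma=\frac{(\lambda_{\max})_\kappa\,\|B_\gamma^{1/2}R_{\gamma\kappa}H_\kappa^{-1/2}\|_2^2}{\alpha_{\gamma\kappa}}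 .$$ Then the discretization is energy stable: for the homogeneous problem ($\mathcal F=0$, $\mathcal U_{\mathcal D}=0$, $\mathcal U_{\mathcal N}=0$), every solution $w_h(t)$ of the semi-discretization has $\sum_\kappa w_\kappa(t)^TH_\kappa w_\kappa(t)$ non-increasing in $t$.
   Context: **Domain and PDE.** $\Omega\subset\mathbb R^2$ is a compact domain whose boundary is $\Gamma=\Gamma^{\mathcal D}\cup\Gamma^{\mathcal N}$ (disjoint, $\Gamma^{\mathcal D}\neq\emptyset$). $\Lambda=\begin{bmatrix}\lambda_{xx}&\lambda_{xy}\\ \lambda_{yx}&\lambda_{yy}\end{bmatrix}$ is a (possibly spatially varying) symmetric positive-definite tensor. The PDE is $\partial_t\mathcal U-\nabla\cdot(\Lambda\nabla\mathcal U)=\mathcal F$ with $\mathcal U=\mathcal U_{\mathcal D}$ on $\Gamma^{\mathcal D}$ and $\hat n\cdot(\Lambda\nabla\mathcal U)=\mathcal U_{\mathcal N}$ on $\Gamma^{\mathcal N}$. **Mesh.** $\Omega$ is partitioned into finitely many elements $\Omega_\kappa$ with piecewise smooth boundary $\Gamma_\kappa=\partial\Omega_\kappa$ consisting of finitely many faces. Each face $\gamma$ is either interior (shared by exactly two elements $\kappa,\nu$; the set of interior faces of $\kappa$ is $\Gamma^{\mathcal I}_\kappa$), or contained in $\Gamma^{\mathcal D}$ (Dirichlet face), or contained in $\Gamma^{\mathcal N}$ (Neumann face); $\Gamma_\kappa^{\mathcal D}=\Gamma_\kappa\cap\Gamma^{\mathcal D}$, $\Gamma_\kappa^{\mathcal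 N}=\Gamma_\kappa\cap\Gamma^{\mathcal N}$. **SBP operators of degree $p$.** Each element has $n_\kappa$ nodes, a diagonal matrix $H_\kappa$ with positive diagonal, and matrices $D_x,D_y\in\mathbb R^{n_\kappa\times n_\kappa}$ that differentiate exactly (in $x$, resp. $y$, at the nodes) the nodal values of every polynomial of total degree $\le p$. Moreover $H_\kappa D_x=S_x+\tfrac12E_x$ with $S_x^T=-S_x$, $E_x^T=E_x$, $p^TE_xq=\oint_{\partial\Omega_\kappa}\mathcal P\mathcal Q\,n_x\,d\Gamma$ for all polynomials $\mathcal P,\mathcal Q$ of total degree $\le r$ (with nodal vectors $p,q$), for some $r\ge p$, and $E_x=\sum_{\gamma\subset\Gamma_\kappa}R_{\gamma\kappa}^TN_{x,\gamma}B_\gamma R_{\gamma\kappa}$; analogously for $y$. Here each face $\gamma$ has $n_\gamma$ cubature nodes with positive weights (exact for degree $2r$), $B_\gamma$ is the diagonal matrix of the weights, $N_{x,\gamma},N_{y,\gamma}$ are the diagonal matrices of the components at the face nodes of the unit normal outward to $\kappa$, and $R_{\gamma\kappa}\in\mathbb R^{n_\gamma\times n_\kappa}$ maps the element nodal values of any polynomial of total degree $\le r$ exactly to its values at the nodes of $\gamma$. **Discrete operators.** $\Lambda_{xx},\Lambda_{xy},\Lambda_{yx},\Lambda_{yy}$ are the diagonal matrices of the entries of $\Lambda$ at the element nodes. On element $\kappa$: $D_\kappa=D_x(\Lambda_{xx}D_x+\Lambda_{xy}D_y)+D_y(\Lambda_{yx}D_x+\Lambda_{yy}D_y)$. On a face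 $\gamma$ of $\kappa$: $D_{\gamma\kappa}=N_{x,\gamma}R_{\gamma\kappa}(\Lambda_{xx}D_x+\Lambda_{xy}D_y)_\kappa+N_{y,\gamma}R_{\gamma\kappa}(\Lambda_{yx}D_x+\Lambda_{yy}D_y)_\kappa$ with the normal outward to $\kappa$; for the neighbour $\nu$ across $\gamma$, $D_{\gamma\nu}$ is the same expression with $\nu$'s operators and the opposite normal (outward to $\nu$). **Semi-discretization.** $u_h$ is the concatenation of the vectors $u_\kappa\in\mathbb R^{n_\kappa}$. On each element, $\dfrac{du_\kappa}{dt}=D_\kappa u_\kappa+f_\kappa-H_\kappa^{-1}s^{\mathcal I}_\kappa-H_\kappa^{-1}s^{\mathcal B}_\kappa$, with $f_\kappa$ the nodal values of $\mathcal F$ and $$s^{\mathcal I}_\kappa(u_h)=\sum_{\gamma\subset\Gamma^{\mathcal I}_\kappa}\begin{bmatrix}R_{\gamma\kappa}^T&D_{\gamma\kappa}^T\end{bmatrix}\begin{bmatrix}\Sigma^{(1)}_{\gamma\kappa}&\Sigma^{(3)}_{\gamma\kappa}\\ \Sigma^{(2)}_{\gamma\kappa}&\Sigma^{(4)}_{\gamma\kappa}\end{bmatrix}\begin{bmatrix}R_{\gamma\kappa}u_\kappa-R_{\gamma\nu}u_\nu\\ D_{\gamma\kappa}u_\kappa+D_{\gamma\nu}u_\nu\end{bmatrix},$$ $$s^{\mathcal B}_\kappa=\sum_{\gamma\subset\Gamma^{\mathcal D}_\kappa}\begin{bmatrix}R_{\gamma\kappa}^T&D_{\gamma\kappa}^T\end{bmatrix}\begin{bmatrix}\Sigma^{\mathcal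 D}_\gamma\\-B_\gamma\end{bmatrix}(R_{\gamma\kappa}u_\kappa-u_{\gamma\mathcal D})+\sum_{\gamma\subset\Gamma^{\mathcal N}_\kappa}R_{\gamma\kappa}^TB_\gamma(D_{\gamma\kappa}u_\kappa-u_{\gamma\mathcal N}),$$ where $\nu$ is the element sharing $\gamma$ with $\kappa$, and $u_{\gamma\mathcal D},u_{\gamma\mathcal N}$ are $\mathcal U_{\mathcal D},\mathcal U_{\mathcal N}$ at the nodes of $\gamma$. *)

(* Defs.v *)
From HB Require Import structures.
From mathcomp Require Import all_boot all_order all_algebra.
From mathcomp Require Import all_classical all_reals all_analysis.

Set Implicit Arguments.
Unset Strict Implicit.
Unset Printing Implicit Defensive.

Import Order.TTheory GRing.Theory Num.Theory.
Import numFieldNormedType.Exports.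

Local Open Scope classical_set_scope.
Local Open Scope ring_scope.

(* The canonical topology and norm on matrices are the product topology and
   the max norm, so the Euclidean norm has to be defined. *)
Definition l2norm (R : realType) (n : nat) (x : 'cV[R]_n) : R :=
  Num.sqrt (\sum_i x i 0 ^+ 2).

Definition mxnorm2 (R : realType) (m n : nat) (A : 'M[R]_(m, n)) : R :=
  sup [set l2norm (A *m x) | x in [set x : 'cV[R]_n | l2norm x <= 1]].

(* For a symmetric real matrix of positive size the spectrum is finite and
   nonempty, and this [sup] is its largest element. *)
Definition max_eigenvalue (R : realType) (n : nat) (A : 'M[R]_n) : R :=
  sup [set a : R | eigenvalue A a].

Definition posdef (R : realType) (n : nat) (A : 'M[R]_n) : Prop :=
  forall x : 'cV[R]_n, x != 0 -> 0 < (x^T *m A *m x) 0 0.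

Definition frontier (T : topologicalType) (A : set T) : set T :=
  closure A `\` A°.

(* A polynomial in x and y is seen as a polynomial in x with coefficients in
   R[y], so P`_i`_j is the coefficient of x^i y^j. *)
Notation poly2 R := {poly {poly R}}.

Definition tdeg_le (R : realType) (d : nat) (P : poly2 R) : Prop :=
  forall i j : nat, P`_i`_j != 0 -> (i + j <= d)%N.

Definition peval (R : realType) (P : poly2 R) (x : 'cV[R]_2) : R :=
  P.[(x 0 0)%:P].[x 1 0].

Definition pderiv (R : realType) (i : 'I_2) (P : poly2 R) : poly2 R :=
  if i == 0 then P^`() else map_poly (@deriv R) P.

(* A domain is a nonempty connected open set; a compact domain is the closure
   of a bounded one. *)
Record domain (R : realType) := Domain {
  Omega : set 'cV[R]_2;
  GammaD : set 'cV[R]_2;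
  GammaN : set 'cV[R]_2;
  Lambda : 'cV[R]_2 -> 'M[R]_2;
  Omega_compact : compact Omega;
  Omega_domain : exists U : set 'cV[R]_2,
    [/\ open U, connected U, U !=set0 & Omega = closure U];
  GammaDN_cover : GammaD `|` GammaN = frontier Omega;
  GammaDN_disjoint : GammaD `&` GammaN = set0;
  GammaD_neq0 : GammaD !=set0;
  Lambda_sym : forall x, Omega x -> (Lambda x)^T = Lambda x;
  Lambda_posdef : forall x, Omega x -> posdef (Lambda x)
}.

Inductive face_kind := Interior | Dirichlet | Neumann.

Definition is_interior (a : face_kind) : bool :=
  if a is Interior then true else false.
Definition is_dirichlet (a : face_kind) : bool :=
  if a is Dirichlet then true else false.
Definition is_neumann (a : face_kind) : bool :=
  if a is Neumann then true else false.

(* Each face is a regular C^1 arc parametrized by [0, 1], simple except that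
   its end points may coincide.  End points of faces are corners, possibly
   shared by faces of different kinds, so non-overlap and inclusion in GammaD
   or GammaN concern open arcs.  The outward normal is continuous up to the
   end points, where cubature nodes are allowed to lie.  On an interior face
   the outward normals of the two elements are opposite, since the interiors
   of the elements are disjoint. *)
Record mesh (R : realType) (dom : domain R) := Mesh {
  elt : finType;
  face : finType;
  region : elt -> set 'cV[R]_2;
  faces : elt -> {set face};
  kind : face -> face_kind;
  arc : face -> R -> 'cV[R]_2;
  darc : face -> R -> 'cV[R]_2;
  normal : face -> elt -> R -> 'cV[R]_2;

  region_cover : \bigcup_k region k = Omega dom;
  region_closure : forall k, region k = closure (region k)°;
  region_neq0 : forall k, region k !=set0;
  region_disjoint : forall k l, k != l ->
    (region k)° `&` (region l)° = set0;
  region_frontier : forall k,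
    frontier (region k) =
      \bigcup_(g in [set g | g \in faces k]) (arc g @` `[0, 1]%classic);

  arc_cont : forall g, {within `[0, 1]%classic, continuous (arc g)};
  darc_cont : forall g, {within `[0, 1]%classic, continuous (darc g)};
  arc_derive : forall g (s : R), s \in `]0, 1[ ->
    is_derive s (1 : R) (arc g) (darc g s);
  darc_neq0 : forall g (s : R), s \in `[0, 1] -> darc g s != 0;
  arc_simple : forall g (s t : R), s \in `]0, 1[ -> t \in `[0, 1] ->
    arc g s = arc g t -> s = t;
  arc_disjoint : forall g g', g != g' ->
    (arc g @` `]0, 1[%classic) `&` (arc g' @` `]0, 1[%classic) = set0;

  kind_card : forall g, #|[pred k | g \in faces k]| =
    (if is_interior (kind g) then 2 else 1)%N;
  dirichlet_sub : forall g, is_dirichlet (kind g) ->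
    arc g @` `]0, 1[%classic `<=` GammaD dom;
  neumann_sub : forall g, is_neumann (kind g) ->
    arc g @` `]0, 1[%classic `<=` GammaN dom;

  normal_cont : forall k g, g \in faces k ->
    {within `[0, 1]%classic, continuous (normal g k)};
  normal_unit : forall k g (s : R), g \in faces k -> s \in `[0, 1] ->
    l2norm (normal g k s) = 1;
  normal_orth : forall k g (s : R), g \in faces k -> s \in `[0, 1] ->
    (normal g k s)^T *m darc g s = 0;
  normal_outward : forall k g (s : R), g \in faces k -> s \in `]0, 1[ ->
    \forall e \near (0 : R)^'+,
      (region k)° (arc g s - e *: normal g k s) /\
      ~ region k (arc g s + e *: normal g k s)
}.

Arguments region {R dom} _ _.
Arguments faces {R dom} _ _.
Arguments kind {R dom _} _.
Arguments arc {R dom} _ _ _.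
Arguments darc {R dom} _ _ _.
Arguments normal {R dom} _ _ _ _.

(* [f] is given as a function of the parameter of the arc. *)
Definition line_integral (R : realType) (dom : domain R) (M : mesh dom)
    (g : face M) (f : R -> R) : R :=
  Rintegral lebesgue_measure `[0, 1]%classic
    (fun s => f s * l2norm (darc M g s)).

(* The element on the other side of an interior face. *)
Definition neighbour (R : realType) (dom : domain R) (M : mesh dom)
    (k : elt M) (g : face M) : elt M :=
  odflt k [pick l | (l != k) && (g \in faces M l)].

(* The direction i : 'I_2 is x for i = 0 and y for i = 1.  The entries of
   [hw k] are the diagonal of H_k, those of [bw g] the diagonal of B_g; the
   nodes of [g] are the points of its arc with parameters [fpar g].  Only the
   matrices [Rx g k] with g a face of k are meaningful. *)
Record sbp (R : realType) (dom : domain R) (M : mesh dom) (p : nat) := SBP {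
  nn : elt M -> nat;
  nf : face M -> nat;
  node : forall k : elt M, 'I_(nn k) -> 'cV[R]_2;
  fpar : forall g : face M, 'I_(nf g) -> R;
  hw : forall k : elt M, 'rV[R]_(nn k);
  bw : forall g : face M, 'rV[R]_(nf g);
  Dx : 'I_2 -> forall k : elt M, 'M[R]_(nn k);
  Sx : 'I_2 -> forall k : elt M, 'M[R]_(nn k);
  Ex : 'I_2 -> forall k : elt M, 'M[R]_(nn k);
  Rx : forall (g : face M) (k : elt M), 'M[R]_(nf g, nn k);
  rdeg : elt M -> nat;

  node_in : forall k a, region M k (@node k a);
  hw_gt0 : forall k a, 0 < hw k 0 a;
  fpar_in : forall g j, @fpar g j \in `[0, 1];
  bw_gt0 : forall g j, 0 < bw g 0 j;

  rdeg_ge : forall k, (p <= rdeg k)%N;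

  bw_exact : forall k g (P : poly2 R), g \in faces M k ->
    tdeg_le (2 * rdeg k) P ->
    \sum_j bw g 0 j * peval P (arc M g (@fpar g j)) =
      line_integral g (fun s => peval P (arc M g s));

  Rx_exact : forall k g (P : poly2 R), g \in faces M k ->
    tdeg_le (rdeg k) P ->
    Rx g k *m \col_a peval P (@node k a) =
      \col_j peval P (arc M g (@fpar g j));

  Dx_exact : forall i k (P : poly2 R), tdeg_le p P ->
    Dx i k *m \col_a peval P (@node k a) =
      \col_a peval (pderiv i P) (@node k a);

  HDx : forall i k, diag_mx (hw k) *m Dx i k = Sx i k + 2^-1 *: Ex i k;
  Sx_skew : forall i k, (Sx i k)^T = - Sx i k;
  Ex_sym : forall i k, (Ex i k)^T = Ex i k;
  Ex_exact : forall i k (P Q : poly2 R),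
    tdeg_le (rdeg k) P -> tdeg_le (rdeg k) Q ->
    ((\col_a peval P (@node k a))^T *m Ex i k
       *m (\col_a peval Q (@node k a))) 0 0 =
      \sum_(g in faces M k) line_integral g (fun s =>
        peval P (arc M g s) * peval Q (arc M g s) * normal M g k s i 0);
  Ex_faces : forall i k,
    Ex i k = \sum_(g in faces M k)
      (Rx g k)^T *m diag_mx (\row_j normal M g k (@fpar g j) i 0)
        *m diag_mx (bw g) *m Rx g k
}.

Arguments nn {R dom M p} _ _.
Arguments nf {R dom M p} _ _.
Arguments node {R dom M p} _ {k} _.
Arguments fpar {R dom M p} _ {g} _.
Arguments hw {R dom M p} _ _.
Arguments bw {R dom M p} _ _.
Arguments Dx {R dom M p} _ _ _.
Arguments Rx {R dom M p} _ _ _.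

Definition Hmx (R : realType) (dom : domain R) (M : mesh dom) (p : nat)
    (O : sbp M p) (k : elt M) : 'M[R]_(nn O k) :=
  diag_mx (hw O k).

Definition Bmx (R : realType) (dom : domain R) (M : mesh dom) (p : nat)
    (O : sbp M p) (g : face M) : 'M[R]_(nf O g) :=
  diag_mx (bw O g).

Definition Hmx_invsqrt (R : realType) (dom : domain R) (M : mesh dom)
    (p : nat) (O : sbp M p) (k : elt M) : 'M[R]_(nn O k) :=
  diag_mx (\row_a (Num.sqrt (hw O k 0 a))^-1).

Definition Bmx_sqrt (R : realType) (dom : domain R) (M : mesh dom)
    (p : nat) (O : sbp M p) (g : face M) : 'M[R]_(nf O g) :=
  diag_mx (\row_j Num.sqrt (bw O g 0 j)).

Definition Nmx (R : realType) (dom : domain R) (M : mesh dom) (p : nat)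
    (O : sbp M p) (i : 'I_2) (g : face M) (k : elt M) : 'M[R]_(nf O g) :=
  diag_mx (\row_j normal M g k (fpar O j) i 0).

Definition Lmx (R : realType) (dom : domain R) (M : mesh dom) (p : nat)
    (O : sbp M p) (i j : 'I_2) (k : elt M) : 'M[R]_(nn O k) :=
  diag_mx (\row_a Lambda dom (node O a) i j).

Definition Lmx_block (R : realType) (dom : domain R) (M : mesh dom) (p : nat)
    (O : sbp M p) (k : elt M) : 'M[R]_(nn O k + nn O k) :=
  block_mx (Lmx O 0 0 k) (Lmx O 0 1 k) (Lmx O 1 0 k) (Lmx O 1 1 k).

Definition flux (R : realType) (dom : domain R) (M : mesh dom) (p : nat)
    (O : sbp M p) (i : 'I_2) (k : elt M) : 'M[R]_(nn O k) :=
  Lmx O i 0 k *m Dx O 0 k + Lmx O i 1 k *m Dx O 1 k.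

Definition Dvol (R : realType) (dom : domain R) (M : mesh dom) (p : nat)
    (O : sbp M p) (k : elt M) : 'M[R]_(nn O k) :=
  Dx O 0 k *m flux O 0 k + Dx O 1 k *m flux O 1 k.

(* The normal is the one outward to [k]. *)
Definition Dface (R : realType) (dom : domain R) (M : mesh dom) (p : nat)
    (O : sbp M p) (g : face M) (k : elt M) : 'M[R]_(nf O g, nn O k) :=
  Nmx O 0 g k *m Rx O g k *m flux O 0 k +
  Nmx O 1 g k *m Rx O g k *m flux O 1 k.

Record penalties (R : realType) (dom : domain R) (M : mesh dom) (p : nat)
    (O : sbp M p) := Penalties {
  Sigma1 : forall (g : face M) (k : elt M), 'M[R]_(nf O g);
  Sigma2 : forall (g : face M) (k : elt M), 'M[R]_(nf O g);
  Sigma3 : forall (g : face M) (k : elt M), 'M[R]_(nf O g);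
  Sigma4 : forall (g : face M) (k : elt M), 'M[R]_(nf O g);
  SigmaD : forall g : face M, 'M[R]_(nf O g)
}.

Arguments Sigma1 {R dom M p O} _ _ _.
Arguments Sigma2 {R dom M p O} _ _ _.
Arguments Sigma3 {R dom M p O} _ _ _.
Arguments Sigma4 {R dom M p O} _ _ _.
Arguments SigmaD {R dom M p O} _ _.

Definition sat_interior (R : realType) (dom : domain R) (M : mesh dom)
    (p : nat) (O : sbp M p) (S : penalties O)
    (u : forall k : elt M, 'cV[R]_(nn O k)) (k : elt M) : 'cV[R]_(nn O k) :=
  \sum_(g in faces M k | is_interior (kind g))
    let v := neighbour k g in
    row_mx (Rx O g k)^T (Dface O g k)^T
    *m block_mx (Sigma1 S g k) (Sigma3 S g k) (Sigma2 S g k) (Sigma4 S g k)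
    *m col_mx (Rx O g k *m u k - Rx O g v *m u v)
              (Dface O g k *m u k + Dface O g v *m u v).

Definition sat_boundary (R : realType) (dom : domain R) (M : mesh dom)
    (p : nat) (O : sbp M p) (S : penalties O)
    (UD UN : 'cV[R]_2 -> R)
    (u : forall k : elt M, 'cV[R]_(nn O k)) (k : elt M) : 'cV[R]_(nn O k) :=
  \sum_(g in faces M k | is_dirichlet (kind g))
    row_mx (Rx O g k)^T (Dface O g k)^T
    *m col_mx (SigmaD S g) (- Bmx O g)
    *m (Rx O g k *m u k - \col_j UD (arc M g (fpar O j)))
  + \sum_(g in faces M k | is_neumann (kind g))
    (Rx O g k)^T *m Bmx O g
    *m (Dface O g k *m u k - \col_j UN (arc M g (fpar O j))).

Definition semidiscrete_rhs (R : realType) (dom : domain R) (M : mesh dom)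
    (p : nat) (O : sbp M p) (S : penalties O)
    (F UD UN : 'cV[R]_2 -> R)
    (u : forall k : elt M, 'cV[R]_(nn O k)) (k : elt M) : 'cV[R]_(nn O k) :=
  Dvol O k *m u k + \col_a F (node O a)
  - invmx (Hmx O k) *m sat_interior S u k
  - invmx (Hmx O k) *m sat_boundary S UD UN u k.

(* Solutions on a time interval J, continuous up to the end points of J that
   belong to it; the data F, UD, UN depend on time and position. *)
Definition semidiscrete_solution (R : realType) (dom : domain R)
    (M : mesh dom) (p : nat) (O : sbp M p) (S : penalties O)
    (F UD UN : R -> 'cV[R]_2 -> R) (J : interval R)
    (u : R -> forall k : elt M, 'cV[R]_(nn O k)) : Prop :=
  forall k : elt M,
    {within [set` J], continuous (fun t => u t k)} /\
    (forall t : R, [set` J]° t ->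
       is_derive t (1 : R) (fun s => u s k)
         (semidiscrete_rhs S (F t) (UD t) (UN t) (u t) k)).

Definition energy (R : realType) (dom : domain R) (M : mesh dom) (p : nat)
    (O : sbp M p) (u : forall k : elt M, 'cV[R]_(nn O k)) : R :=
  \sum_k ((u k)^T *m Hmx O k *m u k) 0 0.

Definition energy_stable (R : realType) (dom : domain R) (M : mesh dom)
    (p : nat) (O : sbp M p) (S : penalties O) : Prop :=
  forall (J : interval R) (w : R -> forall k : elt M, 'cV[R]_(nn O k)),
    semidiscrete_solution S (fun _ _ => 0) (fun _ _ => 0) (fun _ _ => 0) J w ->
    forall s t : R, s \in J -> t \in J -> s <= t ->
      energy (w t) <= energy (w s).

(* (lambda_max)_k ||B_g^(1/2) R_gk H_k^(-1/2)||_2^2 *)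
Definition trace_const (R : realType) (dom : domain R) (M : mesh dom)
    (p : nat) (O : sbp M p) (g : face M) (k : elt M) : R :=
  max_eigenvalue (Lmx_block O k) *
  mxnorm2 (Bmx_sqrt O g *m Rx O g k *m Hmx_invsqrt O k) ^+ 2.

Definition delta1 (R : realType) (dom : domain R) (M : mesh dom) (p : nat)
    (O : sbp M p) (alpha : face M -> elt M -> R)
    (g : face M) (k v : elt M) : R :=
  trace_const O g k / (4 * alpha g k) + trace_const O g v / (4 * alpha g v).

Definition deltaD (R : realType) (dom : domain R) (M : mesh dom) (p : nat)
    (O : sbp M p) (alpha : face M -> elt M -> R)
    (g : face M) (k : elt M) : R :=
  trace_const O g k / alpha g k.

(* Main.v *)
(* With zero data, summation by parts turns half the time derivative of the
   energy into minus the volume dissipation G_k (the discrete integral of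
   grad u . Lambda grad u) plus terms on the faces.  On an interior face shared
   by k and v, the choice Sigma3 = - Sigma2 = B / 2, Sigma4 = 0 leaves
   <u_k - u_v, D_k u_k - D_v u_v> - delta |u_k - u_v|^2 in the inner product
   weighted by B; on a Dirichlet face one gets 2 <u, D u> - delta |u|^2 and on
   a Neumann face 0.  The norm of the normal flux D u on a face of k satisfies
   |D u|^2 <= T G_k, where T is lambda_max times the squared norm of
   B^(1/2) R H^(-1/2), so AM-GM together with the stated penalties bounds the
   terms of a face by alpha_gk G_k + alpha_gv G_v.  The alpha_gk sum to 1 over
   the faces of k, so the dissipation absorbs all of them. *)
Require Import Defs.
From HB Require Import structures.
From mathcomp Require Import all_boot all_order all_algebra.
From mathcomp Require Import all_classical all_reals all_analysis.
From mathcomp Require Import ring lra.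

Import Order.TTheory GRing.Theory Num.Theory.
Import numFieldNormedType.Exports.

Local Open Scope ring_scope.

Set Implicit Arguments.
Unset Strict Implicit.

(** * Inner products with diagonal weights, Cauchy-Schwarz and AM-GM *)

Definition wdot (R : realType) (n : nat) (w : 'rV[R]_n) (x y : 'cV[R]_n) : R :=
  (x^T *m diag_mx w *m y) 0 0.

Lemma wdotE (R : realType) (n : nat) (w : 'rV[R]_n) (x y : 'cV[R]_n) :
  wdot w x y = \sum_a w 0 a * (x a 0 * y a 0).
Proof.
rewrite /wdot mxE; apply: eq_bigr => a _.
by rewrite mul_mx_diag !mxE -mulrA mulrCA.
Qed.

Lemma wdotC (R : realType) (n : nat) (w : 'rV[R]_n) (x y : 'cV[R]_n) :
  wdot w x y = wdot w y x.
Proof. by rewrite !wdotE; apply: eq_bigr => a _; rewrite (mulrC (x a 0)). Qed.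

Lemma wdotDr (R : realType) (n : nat) (w : 'rV[R]_n) (x y z : 'cV[R]_n) :
  wdot w x (y + z) = wdot w x y + wdot w x z.
Proof. by rewrite /wdot mulmxDr mxE. Qed.

Lemma wdotNr (R : realType) (n : nat) (w : 'rV[R]_n) (x y : 'cV[R]_n) :
  wdot w x (- y) = - wdot w x y.
Proof. by rewrite /wdot mulmxN mxE. Qed.

Lemma wdotBr (R : realType) (n : nat) (w : 'rV[R]_n) (x y z : 'cV[R]_n) :
  wdot w x (y - z) = wdot w x y - wdot w x z.
Proof. by rewrite wdotDr wdotNr. Qed.

Lemma wdotBl (R : realType) (n : nat) (w : 'rV[R]_n) (x y z : 'cV[R]_n) :
  wdot w (y - z) x = wdot w y x - wdot w z x.
Proof. by rewrite !(wdotC w _ x) wdotBr. Qed.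

Lemma wdot_ge0 (R : realType) (n : nat) (w : 'rV[R]_n) (x : 'cV[R]_n) :
  (forall a, 0 < w 0 a) -> 0 <= wdot w x x.
Proof.
move=> w0; rewrite wdotE sumr_ge0// => a _.
by rewrite mulr_ge0 ?(ltW (w0 a))// -expr2 sqr_ge0.
Qed.

(** Lagrange's identity: twice the difference of the two sides is a double sum of squares with
    nonnegative weights. *)
Lemma wdot_CauchySchwarz (R : realType) (n : nat) (w : 'rV[R]_n)
    (x y : 'cV[R]_n) : (forall a, 0 < w 0 a) ->
  wdot w x y ^+ 2 <= wdot w x x * wdot w y y.
Proof.
move=> w0.
have : 0 <= \sum_a \sum_b w 0 a * w 0 b * (x a 0 * y b 0 - x b 0 * y a 0) ^+ 2.
  apply: sumr_ge0 => a _; apply: sumr_ge0 => b _.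
  by rewrite mulr_ge0 ?sqr_ge0// mulr_ge0// ltW.
have -> : \sum_a \sum_b w 0 a * w 0 b * (x a 0 * y b 0 - x b 0 * y a 0) ^+ 2
    = 2 * (wdot w x x * wdot w y y - wdot w x y ^+ 2).
  have prodE (f g : 'I_n -> R) :
      (\sum_a f a) * (\sum_b g b) = \sum_a \sum_b f a * g b.
    by rewrite mulr_suml; apply: eq_bigr => a _; rewrite mulr_sumr.
  (* The product is written in both orders so that, once expanded into double sums, the two sides
     agree summand by summand. *)
  have -> : 2 * (wdot w x x * wdot w y y - wdot w x y ^+ 2) =
      wdot w x x * wdot w y y + wdot w y y * wdot w x x
      - 2 * (wdot w x y * wdot w x y) by ring.
  rewrite !wdotE !prodE mulr_sumr -sumrN -!big_split; apply: eq_bigr => a _ /=.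
  rewrite mulr_sumr -sumrN -!big_split; apply: eq_bigr => b _ /=.
  by ring.
by rewrite pmulr_rge0// subr_ge0.
Qed.

(* AM-GM on [T / (4 a) * X] and [a * G]; [T = 0] is allowed. *)
Lemma young_weighted (R : realType) (s X C T G a : R) :
  0 < a -> 0 <= X -> 0 <= T -> 0 <= G ->
  s ^+ 2 <= X * C -> C <= T * G -> s <= T / (4 * a) * X + a * G.
Proof.
move=> a0 X0 T0 G0 sXC CTG.
set P := T / (4 * a) * X; set Q := a * G.
have P0 : 0 <= P by rewrite mulr_ge0// divr_ge0// mulr_ge0// ltW.
have Q0 : 0 <= Q by rewrite mulr_ge0// ltW.
have PQ : 4 * (P * Q) = X * (T * G) by rewrite /P /Q; field; rewrite gt_eqF.
have sPQ : s ^+ 2 <= 4 * (P * Q).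
  by rewrite PQ (le_trans sXC)// ler_wpM2l.
(* The sign of [s] is unknown, so squares are compared only under [s > P + Q >= 0], where
   [(P + Q) ^+ 2 < 4 * (P * Q)] contradicts [0 <= (P - Q) ^+ 2]. *)
rewrite leNgt; apply/negP => sgt.
have : (P + Q) ^+ 2 < s ^+ 2 by rewrite ltr_pXn2r// nnegrE; lra.
by have := sqr_ge0 (P - Q); nra.
Qed.

(** * The Euclidean norm and the matrix 2-norm *)

Lemma l2norm_sqr (R : realType) (n : nat) (x : 'cV[R]_n) :
  l2norm x ^+ 2 = \sum_i x i 0 ^+ 2.
Proof. by rewrite sqr_sqrtr// sumr_ge0// => i _; rewrite sqr_ge0. Qed.

Lemma l2norm_ge0 (R : realType) (n : nat) (x : 'cV[R]_n) : 0 <= l2norm x.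
Proof. exact: sqrtr_ge0. Qed.

Lemma l2normZ (R : realType) (n : nat) (c : R) (x : 'cV[R]_n) :
  0 <= c -> l2norm (c *: x) = c * l2norm x.
Proof.
move=> c0; apply/eqP; rewrite -(@eqrXn2 _ 2)//; last 2 first.
- exact: l2norm_ge0.
- by rewrite mulr_ge0// l2norm_ge0.
rewrite exprMn !l2norm_sqr mulr_sumr; apply/eqP; apply: eq_bigr => i _.
by rewrite mxE exprMn.
Qed.

(** Cauchy-Schwarz on each row. This Frobenius bound shows that the supremum defining [mxnorm2] is
    taken over a bounded set. *)
Lemma l2norm_mulmx_le (R : realType) (m n : nat) (A : 'M[R]_(m, n))
    (x : 'cV[R]_n) :
  l2norm (A *m x) ^+ 2 <= (\sum_i \sum_j A i j ^+ 2) * l2norm x ^+ 2.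
Proof.
rewrite !l2norm_sqr mulr_suml; apply: ler_sum => i _.
have wdot1 (y z : 'cV[R]_n) : wdot (const_mx 1) y z = \sum_a y a 0 * z a 0.
  by rewrite wdotE; apply: eq_bigr => a _; rewrite mxE mul1r.
have c0 a : 0 < (const_mx 1 : 'rV[R]_n) 0 a by rewrite mxE.
have := wdot_CauchySchwarz (row i A)^T x c0; rewrite !wdot1.
congr (_ ^+ 2 <= _ * _).
- by rewrite mxE; apply: eq_bigr => a _; rewrite !mxE.
- by apply: eq_bigr => a _; rewrite !mxE -expr2.
Qed.

Lemma l2norm_le_mxnorm2 (R : realType) (m n : nat) (A : 'M[R]_(m, n))
    (x : 'cV[R]_n) : l2norm (A *m x) <= mxnorm2 A * l2norm x.
Proof.
have le1 (y : 'cV[R]_n) : l2norm y <= 1 -> l2norm (A *m y) <= mxnorm2 A.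
  move=> y1; apply: ub_le_sup; last by exists y.
  exists (Num.sqrt (\sum_i \sum_j A i j ^+ 2)) => _ [z /= z1 <-].
  rewrite -(ger0_norm (l2norm_ge0 _)) -sqrtr_sqr ler_wsqrtr//.
  apply: (le_trans (l2norm_mulmx_le _ _)).
  rewrite ler_piMr//.
    by apply: sumr_ge0 => i _; apply: sumr_ge0 => j _; exact: sqr_ge0.
  by rewrite expr_le1// l2norm_ge0.
(* A vector of norm zero cannot be normalized; the Frobenius bound gives [l2norm (A *m x) = 0]
   directly. *)
have := l2norm_ge0 x; rewrite le_eqVlt => /predU1P[x0|x0].
  have := l2norm_mulmx_le A x; rewrite -x0 expr0n mulr0 /= mulr0.
  by rewrite exprn_even_le0//= => /eqP ->.
rewrite -ler_pdivrMr// mulrC -l2normZ ?invr_ge0 ?l2norm_ge0//.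
rewrite scalemxAr; apply: le1.
by rewrite l2normZ ?invr_ge0 ?l2norm_ge0// mulVf// gt_eqF.
Qed.

(** * Eigenvalues of 2 x 2 tensors and the largest eigenvalue *)

(* If q is the quadratic form of A = [[a, b], [b, d]] and m, a + d - m are the
   eigenvalues of A, Cayley-Hamilton gives
   m q(v) - |A v|^2 = (a + d - m) (m |v|^2 - q(v)). *)
Lemma sqrD_le_eigenvalue2 (R : realType) (a b d m x y : R) :
  0 <= m - a -> 0 <= m - d -> (m - a) * (m - d) = b ^+ 2 -> m <= a + d ->
  (a * x + b * y) ^+ 2 + (b * x + d * y) ^+ 2
    <= m * (a * x ^+ 2 + 2 * b * x * y + d * y ^+ 2).
Proof.
move=> ma md mb ml.
have quad_ge0 : 0 <= (m - a) * x ^+ 2 - 2 * b * x * y + (m - d) * y ^+ 2.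
  have := ma; rewrite le_eqVlt => /predU1P[m0|m0].
    have b0 : b = 0.
      by apply/eqP; rewrite -sqrf_eq0 -mb -m0 mul0r.
    by rewrite b0 -m0 mul0r mulr0 !mul0r subr0 add0r mulr_ge0// sqr_ge0.
  rewrite -(pmulr_rge0 _ m0).
  suff -> : (m - a) * ((m - a) * x ^+ 2 - 2 * b * x * y + (m - d) * y ^+ 2)
    = ((m - a) * x - b * y) ^+ 2 + ((m - a) * (m - d) - b ^+ 2) * y ^+ 2.
    by rewrite mb subrr mul0r addr0 sqr_ge0.
  by ring.
rewrite -subr_ge0.
suff -> : m * (a * x ^+ 2 + 2 * b * x * y + d * y ^+ 2) -
    ((a * x + b * y) ^+ 2 + (b * x + d * y) ^+ 2) =
    (a + d - m) * ((m - a) * x ^+ 2 - 2 * b * x * y + (m - d) * y ^+ 2)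
    + ((m - a) * (m - d) - b ^+ 2) * (x ^+ 2 + y ^+ 2).
  by rewrite mb subrr mul0r addr0 mulr_ge0// subr_ge0.
by ring.
Qed.

(** The hypothesis says that the characteristic polynomial of [A] vanishes at [m]. *)
Lemma eigenvalue2 (R : realType) (A : 'M[R]_2) (m : R) :
  (m - A 0 0) * (m - A 1 1) = A 0 1 * A 1 0 -> eigenvalue A m.
Proof.
move=> h; have /det0P[v v0 vA] : \det (A - m%:M) == 0.
  rewrite (expand_det_row _ 0) !big_ord_recl big_ord0 /cofactor !det_mx11.
  have l0 : lift (0 : 'I_2) (0 : 'I_1) = 1 by exact/val_inj.
  have l1 : lift (1 : 'I_2) (0 : 'I_1) = 0 by exact/val_inj.
  rewrite l0 !mxE l0 l1 !mulr1n !mulr0n !subr0 /= expr0 expr1 mul1r addr0.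
  by rewrite mulN1r mulrN -(mulrNN (_ - m)) !opprB h subrr.
apply/eigenvalueP; exists v => //.
by apply/eqP; rewrite -subr_eq0 -mul_mx_scalar -mulmxBr vA.
Qed.

Definition vec2 (R : realType) (x y : R) : 'cV[R]_2 :=
  \col_i (if i == 0 then x else y).

Lemma quad2E (R : realType) (A : 'M[R]_2) (x y : R) :
  ((vec2 x y)^T *m A *m vec2 x y) 0 0 =
    A 0 0 * x ^+ 2 + (A 0 1 + A 1 0) * x * y + A 1 1 * y ^+ 2.
Proof.
have l01 : lift 0 0 = 1 :> 'I_2 by exact/val_inj.
rewrite !mxE !big_ord_recl !big_ord0 !mxE !big_ord_recl !big_ord0 !mxE.
by rewrite !l01 /=; ring.
Qed.

(** The witness is the larger root of the characteristic polynomial. The inequality,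
    [|A v|^2 <= m (v . A v)], is what bounds a flux by the dissipation at a node. *)
Lemma posdef2_eigenvalue (R : realType) (A : 'M[R]_2) :
  A^T = A -> posdef A -> exists m, [/\ 0 < m, eigenvalue A m &
    forall x y : R, (A 0 0 * x + A 0 1 * y) ^+ 2 + (A 1 0 * x + A 1 1 * y) ^+ 2
      <= m * (x * (A 0 0 * x + A 0 1 * y) + y * (A 1 0 * x + A 1 1 * y))].
Proof.
move=> sA pA.
have A10 : A 1 0 = A 0 1 by rewrite -{1}sA mxE.
have pos x y : (x != 0) || (y != 0) ->
    0 < A 0 0 * x ^+ 2 + (A 0 1 + A 1 0) * x * y + A 1 1 * y ^+ 2.
  move=> xy; rewrite -quad2E; apply: pA; apply: contraTneq xy => v0.
  have := congr1 (fun v : 'cV[R]_2 => v 0 0) v0.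
  have := congr1 (fun v : 'cV[R]_2 => v 1 0) v0.
  by rewrite !mxE /= => -> ->; rewrite eqxx.
(* The unit vectors make both diagonal entries positive; the vector [(- b, a)] has energy
   [a * (a * d - b ^+ 2)], so the determinant is positive too. *)
have := pos 1 0; have := pos 0 1; have := pos (- A 0 1) (A 0 0).
have := @eigenvalue2 R A; rewrite A10.
move: (A 0 0) (A 0 1) (A 1 1) => a b d.
rewrite oner_neq0 orbT /= => ev p1 /(_ isT) d0 /(_ isT) a0.
have {}a0 : 0 < a by lra.
have {}d0 : 0 < d by lra.
have : 0 < a * (a * d - b ^+ 2).
  have /p1 : (- b != 0) || (a != 0) by rewrite (gt_eqF a0) orbT.
  by move/lt_le_trans; apply; rewrite le_eqVlt; apply/predU1P; left; ring.
rewrite pmulr_rgt0// => det0.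
(* [s] is the root of the discriminant. The bound [s <= a + d], from the positive determinant, makes
   the smaller eigenvalue nonnegative; [|a - d| <= s] puts [m] above both diagonal entries. *)
pose s := Num.sqrt ((a - d) ^+ 2 + 4 * b ^+ 2).
have s0 : 0 <= s by exact: sqrtr_ge0.
have s2 : s ^+ 2 = (a - d) ^+ 2 + 4 * b ^+ 2.
  by apply: sqr_sqrtr; have := sqr_ge0 (a - d); have := sqr_ge0 b; lra.
have b2 : 0 <= b ^+ 2 by exact: sqr_ge0.
have sle : s <= a + d.
  by rewrite -(@ler_pXn2r _ 2)// ?nnegrE ?addr_ge0 ?ltW// s2; nra.
have sge : `|a - d| <= s.
  by rewrite -(@ler_pXn2r _ 2)// ?nnegrE// real_normK ?num_real// s2; lra.
have [sge1 sge2] : - s <= a - d /\ a - d <= s by apply/andP; rewrite -ler_norml.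
have mb : ((a + d + s) / 2 - a) * ((a + d + s) / 2 - d) = b ^+ 2.
  transitivity ((s ^+ 2 - (a - d) ^+ 2) / 4); first by field.
  by rewrite s2; field.
exists ((a + d + s) / 2); split; first lra.
  by apply: ev; rewrite mb expr2.
move=> x y; have := @sqrD_le_eigenvalue2 _ a b d _ x y _ _ mb.
move=> /(_ ltac:(lra) ltac:(lra) ltac:(lra)) /le_trans; apply.
by rewrite le_eqVlt; apply/predU1P; left; ring.
Qed.

(** Cauchy's bound on the roots of the characteristic polynomial makes the spectrum bounded, so its
    [sup] is an upper bound. *)
Lemma eigenvalue_le_max (R : realType) (n : nat) (A : 'M[R]_n) (m : R) :
  eigenvalue A m -> m <= max_eigenvalue A.
Proof.
move=> ev; apply: ub_le_sup => //.
have [b bP] := Cauchy_root_bound (monic_neq0 (char_poly_monic A)).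
exists b => c /=; rewrite eigenvalue_root_char => /bP.
exact/le_trans/ler_norm.
Qed.

Lemma delta_mul_diag (R : realType) (n : nat) (d : 'rV[R]_n) (a : 'I_n) :
  delta_mx (0 : 'I_1) a *m diag_mx d = d 0 a *: delta_mx (0 : 'I_1) a.
Proof.
apply/matrixP => i j; rewrite ord1 mul_mx_diag !mxE eqxx /=.
by case: eqP => [->|]; rewrite ?mulr0n ?mul0r ?mulr0// mulr1 mul1r.
Qed.

Lemma sum2E (R : realType) (f : 'I_2 -> R) : \sum_i f i = f 0 + f 1.
Proof.
by rewrite !big_ord_recl big_ord0 addr0; congr (_ + f _); exact/val_inj.
Qed.

(** * Estimates on one element: dissipation, trace inequality, summation by parts *)

Section sbp_operators.
Context (R : realType) (dom : domain R) (M : mesh dom) (p : nat).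
Context (O : sbp M p).
Implicit Types (k : elt M) (g : face M).

Lemma node_Omega k (a : 'I_(nn O k)) : Omega dom (node O a).
Proof. by rewrite -(region_cover M); exists k => //; exact: node_in. Qed.

(** The blocks are diagonal, so the block matrix acts node by node: a left eigenvector [v] of the
    tensor at node [a], placed at that node in both blocks, is an eigenvector. *)
Lemma eigenvalue_Lmx_block k (a : 'I_(nn O k)) (m : R) :
  eigenvalue (Lambda dom (node O a)) m -> eigenvalue (Lmx_block O k) m.
Proof.
move=> /eigenvalueP[v vL v0]; apply/eigenvalueP.
pose e : 'rV[R]_(nn O k) := delta_mx 0 a.
exists (row_mx (v 0 0 *: e) (v 0 1 *: e)); last first.
  apply: contraNneq v0 => /eqP; rewrite row_mx_eq0 => /andP[].
  move=> /eqP/(congr1 (fun w : 'rV[R]_(nn O k) => w 0 a)); rewrite !mxE !eqxx.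
  rewrite mulr1 => v0 /eqP/(congr1 (fun w : 'rV[R]_(nn O k) => w 0 a)).
  rewrite !mxE !eqxx mulr1 => v1; apply/eqP/matrixP => i j; rewrite ord1 mxE.
  by case: j => -[|[|//]] h; [rewrite -v0|rewrite -v1]; congr (v _ _);
    exact/val_inj.
have vLj j :
    v 0 0 * Lambda dom (node O a) 0 j + v 0 1 * Lambda dom (node O a) 1 j =
    m * v 0 j.
  have /(congr1 (fun w : 'rV[R]_2 => w 0 j)) := vL.
  rewrite !mxE !big_ord_recl big_ord0 addr0 => <-.
  by congr (_ + v _ _ * Lambda _ _ _ _); exact/val_inj.
rewrite /Lmx_block mul_row_block scale_row_mx -!scalemxAl.
by rewrite !delta_mul_diag !mxE !scalerA -!scalerDl !vLj.
Qed.

Definition dissipation k (u : 'cV[R]_(nn O k)) : R :=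
  \sum_i wdot (hw O k) (Dx O i k *m u) (flux O i k *m u).

Lemma fluxE i k (u : 'cV[R]_(nn O k)) a :
  (flux O i k *m u) a 0 =
    Lambda dom (node O a) i 0 * (Dx O 0 k *m u) a 0
    + Lambda dom (node O a) i 1 * (Dx O 1 k *m u) a 0.
Proof.
by rewrite /flux mulmxDl -!mulmxA /Lmx !mul_diag_mx !mxE.
Qed.

Lemma Lambda_flux_le k (a : 'I_(nn O k)) :
  0 < max_eigenvalue (Lmx_block O k) /\
  forall u : 'cV[R]_(nn O k),
    \sum_i (flux O i k *m u) a 0 ^+ 2 <= max_eigenvalue (Lmx_block O k) *
      \sum_i (Dx O i k *m u) a 0 * (flux O i k *m u) a 0.
Proof.
have Oa := node_Omega a.
have [m [m0 ev le_m]] := posdef2_eigenvalue (Lambda_sym Oa) (Lambda_posdef Oa).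
have mle := eigenvalue_le_max (eigenvalue_Lmx_block ev).
split=> [|u]; first exact: lt_le_trans m0 mle.
rewrite !sum2E !fluxE.
have := le_m ((Dx O 0 k *m u) a 0) ((Dx O 1 k *m u) a 0).
move=> /le_trans; apply; apply: ler_wpM2r => //.
(* Replacing [m] by the larger [max_eigenvalue] needs a nonnegative form, which holds since [m > 0]
   times the form dominates a sum of squares. *)
rewrite -(pmulr_rge0 _ m0).
by apply: le_trans (le_m _ _); rewrite addr_ge0// sqr_ge0.
Qed.

Lemma max_eigenvalue_Lmx_block_ge0 k : 0 <= max_eigenvalue (Lmx_block O k).
Proof.
(* An element without nodes has an empty spectrum, whose [sup] is 0 by default. *)
have [n0|n0] := posnP (nn O k); last first.
  exact/ltW/(Lambda_flux_le (Ordinal n0)).1.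
rewrite /max_eigenvalue (_ : mkset _ = set0) ?sup0//.
apply/seteqP; split=> // m /= /eigenvalueP[v _ /eqP[]].
apply/matrixP => i j; exfalso.
by case: j => j; rewrite n0.
Qed.

Lemma dissipation_ge0 k (u : 'cV[R]_(nn O k)) : 0 <= dissipation u.
Proof.
rewrite /dissipation; under eq_bigr do rewrite wdotE.
rewrite exchange_big /= sumr_ge0// => a _.
rewrite -mulr_sumr; apply: mulr_ge0; first exact/ltW/hw_gt0.
have [l0 /(_ u) lu] := Lambda_flux_le a; rewrite -(pmulr_rge0 _ l0).
by apply: le_trans lu; apply: sumr_ge0 => i _; exact: sqr_ge0.
Qed.

Lemma wdot_flux_le k (u : 'cV[R]_(nn O k)) :
  \sum_i wdot (hw O k) (flux O i k *m u) (flux O i k *m u) <=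
    max_eigenvalue (Lmx_block O k) * dissipation u.
Proof.
rewrite /dissipation.
under eq_bigr do rewrite wdotE; under [X in _ * X]eq_bigr do rewrite wdotE.
rewrite exchange_big [X in _ * X]exchange_big /= mulr_sumr.
apply: ler_sum => a _.
rewrite -!mulr_sumr mulrCA; apply: ler_wpM2l; first exact/ltW/hw_gt0.
have := (Lambda_flux_le a).2 u; apply: le_trans.
by under eq_bigr do rewrite -expr2.
Qed.

(** Substituting [z = H^(-1/2) x] turns both weighted norms into Euclidean ones, related by the
    matrix 2-norm. *)
Lemma wdot_Rx_le k g (z : 'cV[R]_(nn O k)) :
  wdot (bw O g) (Rx O g k *m z) (Rx O g k *m z) <=
    mxnorm2 (Bmx_sqrt O g *m Rx O g k *m Hmx_invsqrt O k) ^+ 2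
    * wdot (hw O k) z z.
Proof.
have l2norm_sqrt n (w : 'rV[R]_n) (y : 'cV[R]_n) : (forall a, 0 < w 0 a) ->
    l2norm (diag_mx (\row_a Num.sqrt (w 0 a)) *m y) ^+ 2 = wdot w y y.
  move=> w0; rewrite l2norm_sqr wdotE; apply: eq_bigr => a _.
  by rewrite mul_diag_mx !mxE exprMn sqr_sqrtr ?(ltW (w0 a))// -expr2.
rewrite -!l2norm_sqrt; [|exact: hw_gt0|exact: bw_gt0].
set x := diag_mx _ *m z; rewrite -exprMn.
rewrite ler_pXn2r ?nnegrE ?l2norm_ge0//; last first.
  exact: le_trans (l2norm_ge0 _) (l2norm_le_mxnorm2 _ x).
have {1}-> : z = Hmx_invsqrt O k *m x.
  apply/matrixP => a j; rewrite /x /Hmx_invsqrt !mul_diag_mx !mxE mulKf//.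
  by rewrite gt_eqF// sqrtr_gt0 hw_gt0.
by move: x => x; rewrite !mulmxA; exact: l2norm_le_mxnorm2.
Qed.

(** The discrete trace inequality. At each face node the normal component of the extrapolated flux
    is at most its length; [wdot_Rx_le] then passes from the face to the element, and [wdot_flux_le]
    from the flux to the dissipation. *)
Lemma Dface_le k g (u : 'cV[R]_(nn O k)) : g \in faces M k ->
  wdot (bw O g) (Dface O g k *m u) (Dface O g k *m u) <=
    trace_const O g k * dissipation u.
Proof.
move=> gk.
have le_sum : wdot (bw O g) (Dface O g k *m u) (Dface O g k *m u) <=
    \sum_i wdot (bw O g) (Rx O g k *m (flux O i k *m u))
                         (Rx O g k *m (flux O i k *m u)).
  under eq_bigr do rewrite wdotE.
  rewrite wdotE exchange_big /=; apply: ler_sum => j _.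
  rewrite -mulr_sumr; apply: ler_wpM2l; first exact/ltW/bw_gt0.
  rewrite sum2E /Dface mulmxDl -!mulmxA /Nmx !mul_diag_mx !mxE.
  have := normal_unit gk (fpar_in j).
  move=> /(congr1 (fun x : R => x ^+ 2)); rewrite l2norm_sqr expr1n sum2E => nu.
  set n0 := normal _ _ _ _ 0 0 in nu *; set n1 := normal _ _ _ _ 1 0 in nu *.
  move: (\sum_j0 _) (\sum_j0 _) => y x; rewrite -subr_ge0.
  (* Lagrange's identity, with a correction that vanishes because the normal has length 1. *)
  suff -> : x * x + y * y - (n0 * x + n1 * y) * (n0 * x + n1 * y) =
      (n0 * y - n1 * x) ^+ 2 + (1 - (n0 ^+ 2 + n1 ^+ 2)) * (x ^+ 2 + y ^+ 2).
    by rewrite nu subrr mul0r addr0 sqr_ge0.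
  by ring.
apply: (le_trans le_sum).
rewrite /trace_const mulrAC mulrC.
apply: le_trans (ler_wpM2l (sqr_ge0 _) (wdot_flux_le u)).
by rewrite mulr_sumr; apply: ler_sum => i _; exact: wdot_Rx_le.
Qed.

(** As [S] is skew and [E] symmetric, [H D + (H D)^T = E]; the decomposition of [E] over the faces
    gives the boundary terms. *)
Lemma summation_by_parts i k (u f : 'cV[R]_(nn O k)) :
  wdot (hw O k) u (Dx O i k *m f) = - wdot (hw O k) (Dx O i k *m u) f +
    \sum_(g in faces M k) wdot (bw O g) (Rx O g k *m u)
                                (Nmx O i g k *m Rx O g k *m f).
Proof.
apply/eqP; rewrite addrC eq_sym subr_eq; apply/eqP.
have -> : wdot (hw O k) u (Dx O i k *m f) + wdot (hw O k) (Dx O i k *m u) f =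
    (u^T *m Ex O i k *m f) 0 0.
  have <- : diag_mx (hw O k) *m Dx O i k + (diag_mx (hw O k) *m Dx O i k)^T
      = Ex O i k.
    rewrite HDx linearD linearZ /= Sx_skew Ex_sym addrACA subrr add0r -scalerDl.
    by rewrite (_ : 2^-1 + 2^-1 = 1 :> R) ?scale1r//; field.
  by rewrite trmx_mul tr_diag_mx mulmxDr mulmxDl mxE /wdot trmx_mul !mulmxA.
rewrite Ex_faces mulmx_sumr mulmx_suml summxE; apply: eq_bigr => g _.
rewrite /wdot trmx_mul /Nmx !mulmxA; congr ((_ *m _ *m _) 0 0).
by rewrite -!mulmxA (diag_mxC (bw O g)).
Qed.

End sbp_operators.

(** * Penalty terms tested against the solution *)

Lemma mulmx_wdot (R : realType) (m n : nat) (w : 'rV[R]_m) (A : 'M[R]_(m, n))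
    (u : 'cV[R]_n) (y : 'cV[R]_m) :
  (u^T *m (A^T *m diag_mx w *m y)) 0 0 = wdot w (A *m u) y.
Proof. by rewrite /wdot trmx_mul !mulmxA. Qed.

(** Here [A] and [D] play the roles of [Rx] and [Dface], [x] of the solution jump, [y] of the sum of
    the outward normal fluxes, and [c] of the penalty coefficient. *)
Lemma sat_interior_face (R : realType) (m n : nat) (w : 'rV[R]_m)
    (A D : 'M[R]_(m, n)) (u : 'cV[R]_n) (x y : 'cV[R]_m) (c : R) :
  (u^T *m (row_mx A^T D^T
     *m block_mx (c *: diag_mx w) (2^-1 *: diag_mx w)
                 (- (2^-1 *: diag_mx w)) 0
     *m col_mx x y)) 0 0 =
  c * wdot w (A *m u) x + 2^-1 * wdot w (A *m u) y - 2^-1 * wdot w (D *m u) x.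
Proof.
rewrite mul_row_block mul_row_col !mulmx0 addr0 mulmxN !mulmxDl mulNmx !mulmxDr.
rewrite mulmxN -!scalemxAr -!scalemxAl -!scalemxAr addrAC -!mulmx_wdot.
rewrite ![fun_of_matrix (_ + _) _ _]mxE [fun_of_matrix (- _) _ _]mxE.
by rewrite ![fun_of_matrix (_ *: _) _ _]mxE.
Qed.

Lemma sat_dirichlet_face (R : realType) (m n : nat) (w : 'rV[R]_m)
    (A D : 'M[R]_(m, n)) (u : 'cV[R]_n) (x : 'cV[R]_m) (c : R) :
  (u^T *m (row_mx A^T D^T *m col_mx (c *: diag_mx w) (- diag_mx w) *m x)) 0 0 =
  c * wdot w (A *m u) x - wdot w (D *m u) x.
Proof.
rewrite mul_row_col mulmxN mulmxDl mulNmx mulmxDr mulmxN.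
rewrite -scalemxAr -scalemxAl -scalemxAr -!mulmx_wdot.
rewrite [fun_of_matrix (_ + _) _ _]mxE [fun_of_matrix (- _) _ _]mxE.
by rewrite [fun_of_matrix (_ *: _) _ _]mxE.
Qed.

(** * The energy rate, face by face *)

Section semidiscretization.
Context (R : realType) (dom : domain R) (M : mesh dom) (p : nat).
Context (O : sbp M p) (S : penalties O).
Context (u : forall k : elt M, 'cV[R]_(nn O k)).
Implicit Types (k v : elt M) (g : face M).

(** The choice made by [neighbour] is forced: a third element on the face would contradict
    [kind_card]. *)
Lemma neighbourE k v g : is_interior (kind g) -> k != v ->
  g \in faces M k -> g \in faces M v -> neighbour k g = v.
Proof.
move=> gI kv gk gv; rewrite /neighbour; case: pickP => [l|/(_ v)]; last first.
  by rewrite eq_sym kv gv.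
move=> /andP[lk gl] /=; apply/eqP; apply: contraT => lv.
have := kind_card g; rewrite gI => card2.
have : (#|[set k; v; l]| <= #|[pred k | g \in faces M k]|)%N.
  by apply/subset_leq_card/fintype.subsetP => i; rewrite !inE;
    move=> /orP[/orP[]|] /eqP ->.
rewrite card2 -finset.setUA cardsU1 cards2 !inE negb_or.
by rewrite kv eq_sym lk (eq_sym v) lv.
Qed.

Lemma sum_interior_face g : is_interior (kind g) ->
  exists k v, [/\ k != v, g \in faces M k, g \in faces M v &
    forall h : elt M -> R, \sum_(l | g \in faces M l) h l = h k + h v].
Proof.
move=> gI; have := kind_card g; rewrite gI.
rewrite -cardsE => /eqP/cards2P[k [v [kv e]]].
have mem l : (g \in faces M l) = (l == k) || (l == v).
  by rewrite -in_set2 -e !inE.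
exists k, v; split=> //; rewrite ?mem ?eqxx ?orbT// => h.
rewrite (eq_bigl _ _ mem) (bigD1 k) ?eqxx//= (bigD1 v) /=; last first.
  by rewrite eqxx orbT eq_sym.
rewrite big1 ?addr0// => l /andP[/andP[]].
by case: eqP => //= _; case: eqP.
Qed.

(* [\col_j 0] is what zero boundary data leave in [sat_boundary]. *)
Definition face_rate g k : R :=
  wdot (bw O g) (Rx O g k *m u k) (Dface O g k *m u k)
  - ((u k)^T *m
      ((if is_interior (kind g) then
          let v := neighbour k g in
          row_mx (Rx O g k)^T (Dface O g k)^T
          *m block_mx (Sigma1 S g k) (Sigma3 S g k)
                      (Sigma2 S g k) (Sigma4 S g k)
          *m col_mx (Rx O g k *m u k - Rx O g v *m u v)
                    (Dface O g k *m u k + Dface O g v *m u v)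
        else 0)
       + ((if is_dirichlet (kind g) then
             row_mx (Rx O g k)^T (Dface O g k)^T
             *m col_mx (SigmaD S g) (- Bmx O g)
             *m (Rx O g k *m u k - \col_j 0)
           else 0)
          + (if is_neumann (kind g) then
               (Rx O g k)^T *m Bmx O g *m (Dface O g k *m u k - \col_j 0)
             else 0)))) 0 0.

(** Testing with [H u] cancels the inverse of [H] before the penalties, and summation by parts
    splits the volume term into dissipation and face terms. *)
Lemma energy_rateE k :
  ((u k)^T *m Hmx O k *m
     semidiscrete_rhs S (fun=> 0) (fun=> 0) (fun=> 0) u k) 0 0 =
  - dissipation (u k) + \sum_(g in faces M k) face_rate g k.
Proof.
have Hunit : Hmx O k \in unitmx.
  rewrite unitmxE det_diag unitfE; apply/prodf_neq0 => a _.
  by rewrite gt_eqF// hw_gt0.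
have -> : semidiscrete_rhs S (fun=> 0) (fun=> 0) (fun=> 0) u k =
    Dvol O k *m u k - invmx (Hmx O k) *m
      (sat_interior S u k + sat_boundary S (fun=> 0) (fun=> 0) u k).
  rewrite /semidiscrete_rhs (_ : \col_a _ = 0).
    by rewrite addr0 [in RHS]mulmxDr opprD addrA.
  by apply/matrixP => a j; rewrite !mxE.
rewrite mulmxBr (mulmxA _ (invmx _)) mulmxK// mxE [X in _ + X]mxE.
have -> : ((u k)^T *m Hmx O k *m (Dvol O k *m u k)) 0 0 =
    - dissipation (u k) + \sum_(g in faces M k)
      wdot (bw O g) (Rx O g k *m u k) (Dface O g k *m u k).
  rewrite -/(wdot _ _ _) /Dvol mulmxDl wdotDr -!mulmxA !summation_by_parts.
  rewrite /dissipation sum2E addrACA opprD -big_split; congr (_ + _).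
  by apply: eq_bigr => g _; rewrite /= -wdotDr /Dface mulmxDl !mulmxA.
rewrite /face_rate sumrB -addrA; congr (_ + (_ - _)).
rewrite -summxE -mulmx_sumr; congr ((_ *m _) 0 0).
(* The conditionals of [face_rate] become sums restricted to one kind of face, as in the definitions
   of the penalties. *)
rewrite !big_split /= /sat_interior /sat_boundary -!big_mkcondr.
by [].
Qed.

(** The vector [y] is left free: it will be the jump on an interior face and twice the trace on a
    Dirichlet face. *)
Lemma wdot_Dface_le k g (y : 'cV[R]_(nf O g)) (a : R) :
  g \in faces M k -> 0 < a ->
  wdot (bw O g) y (Dface O g k *m u k) <=
    trace_const O g k / (4 * a) * wdot (bw O g) y y + a * dissipation (u k).
Proof.
move=> gk a0; apply: (young_weighted a0 _ _ _ _ (Dface_le _ gk)).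
- exact/wdot_ge0/bw_gt0.
- by rewrite mulr_ge0 ?sqr_ge0// max_eigenvalue_Lmx_block_ge0.
- exact: dissipation_ge0.
- exact/wdot_CauchySchwarz/bw_gt0.
Qed.

Lemma face_rate_interior k v g (c : R) : is_interior (kind g) -> k != v ->
  g \in faces M k -> g \in faces M v ->
  Sigma1 S g k = c *: Bmx O g -> Sigma3 S g k = 2^-1 *: Bmx O g ->
  - Sigma2 S g k = 2^-1 *: Bmx O g -> Sigma4 S g k = 0 ->
  face_rate g k =
    wdot (bw O g) (Rx O g k *m u k) (Dface O g k *m u k)
    - (c * wdot (bw O g) (Rx O g k *m u k) (Rx O g k *m u k - Rx O g v *m u v)
       + 2^-1 * wdot (bw O g) (Rx O g k *m u k)
                     (Dface O g k *m u k + Dface O g v *m u v)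
       - 2^-1 * wdot (bw O g) (Dface O g k *m u k)
                     (Rx O g k *m u k - Rx O g v *m u v)).
Proof.
move=> gI kv gk gv s1 s3 s2 s4.
rewrite /face_rate gI (neighbourE gI kv gk gv) s1 s3 s4.
rewrite -[Sigma2 S g k]opprK s2 -sat_interior_face.
by case: (kind g) gI => // _ /=; rewrite !addr0.
Qed.

Lemma face_rate_interior_le (alpha : face M -> elt M -> R) k v g :
  is_interior (kind g) -> k != v -> g \in faces M k -> g \in faces M v ->
  0 < alpha g k -> 0 < alpha g v ->
  Sigma1 S g k = delta1 O alpha g k v *: Bmx O g ->
  Sigma1 S g v = delta1 O alpha g k v *: Bmx O g ->
  (forall l, g \in faces M l -> [/\ Sigma3 S g l = 2^-1 *: Bmx O g,
     - Sigma2 S g l = 2^-1 *: Bmx O g & Sigma4 S g l = 0]) ->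
  face_rate g k + face_rate g v <=
    alpha g k * dissipation (u k) + alpha g v * dissipation (u v).
Proof.
move=> gI kv gk gv ak av s1k s1v s.
have [s3k s2k s4k] := s k gk; have [s3v s2v s4v] := s v gv.
rewrite (face_rate_interior gI kv gk gv s1k s3k s2k s4k).
have vk : v != k by rewrite eq_sym.
rewrite (face_rate_interior gI vk gv gk s1v s3v s2v s4v).
(* The flux of each side is paired with the jump seen from that side. The two pairings add up to the
   indefinite part of the rate, and the two coefficients [T / (4 alpha)] add up to [delta1]. *)
have := wdot_Dface_le (Rx O g k *m u k - Rx O g v *m u v) gk ak.
have := wdot_Dface_le (Rx O g v *m u v - Rx O g k *m u k) gv av.
rewrite /delta1 !(wdotBr, wdotBl, wdotDr).
rewrite !(wdotC _ (Dface _ _ _ *m _) (Rx _ _ _ *m _)).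
rewrite (wdotC _ (Rx O g v *m u v) (Rx O g k *m u k)).
move: (trace_const O g k / _) (trace_const O g v / _) => Tk Tv.
move: (alpha g k * _) (alpha g v * _) => Gk Gv.
do ![move: (wdot _ _ _) => ?]; lra.
Qed.

Lemma face_rate_dirichlet_le (alpha : face M -> elt M -> R) k g :
  is_dirichlet (kind g) -> g \in faces M k -> 0 < alpha g k ->
  SigmaD S g = deltaD O alpha g k *: Bmx O g ->
  face_rate g k <= alpha g k * dissipation (u k).
Proof.
move=> gD gk ak s; rewrite /face_rate gD.
have -> : is_interior (kind g) = false by case: (kind g) gD.
have -> : is_neumann (kind g) = false by case: (kind g) gD.
rewrite (_ : \col_j 0 = 0 :> 'cV[R]_(nf O g)); last first.
  by apply/matrixP => i j; rewrite !mxE.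
rewrite subr0 add0r addr0 s sat_dirichlet_face.
(* The Dirichlet rate contains the flux pairing twice. With the doubled trace, the 4 from squaring
   cancels the 4 of [T / (4 alpha)] and leaves exactly [deltaD]. *)
have := wdot_Dface_le (2 *: (Rx O g k *m u k)) gk ak.
rewrite (_ : wdot _ (_ *: _) (_ *: _) =
  4 * wdot (bw O g) (Rx O g k *m u k) (Rx O g k *m u k)); last first.
  by rewrite scaler_nat mulr2n wdotDr !(wdotC _ (_ + _)) !wdotDr; ring.
have -> X : trace_const O g k / (4 * alpha g k) * (4 * X)
    = deltaD O alpha g k * X.
  by rewrite /deltaD; field; rewrite gt_eqF.
rewrite [X in X <= _ -> _]wdotC scaler_nat mulr2n wdotDr.
rewrite (wdotC _ (Rx _ _ _ *m _) (Dface _ _ _ *m _)).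
by move: (wdot _ (Dface _ _ _ *m _) _) (deltaD _ _ _ _ * _) => x y; lra.
Qed.

Lemma face_rate_neumann k g : is_neumann (kind g) -> face_rate g k = 0.
Proof.
move=> gN; rewrite /face_rate gN.
have -> : is_interior (kind g) = false by case: (kind g) gN.
have -> : is_dirichlet (kind g) = false by case: (kind g) gN.
rewrite (_ : \col_j 0 = 0 :> 'cV[R]_(nf O g)); last first.
  by apply/matrixP => i j; rewrite !mxE.
by rewrite !add0r subr0 mulmx_wdot subrr.
Qed.

End semidiscretization.

Lemma energy_rate_le0 (R : realType) (dom : domain R) (M : mesh dom) (p : nat)
    (O : sbp M p) (S : penalties O) (alpha : face M -> elt M -> R)
    (hS3 : forall (k : elt M) (g : face M), g \in faces M k ->
       is_interior (kind g) -> Sigma3 S g k = 2^-1 *: Bmx O g)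
    (hS2 : forall (k : elt M) (g : face M), g \in faces M k ->
       is_interior (kind g) -> - Sigma2 S g k = 2^-1 *: Bmx O g)
    (hS4 : forall (k : elt M) (g : face M), g \in faces M k ->
       is_interior (kind g) -> Sigma4 S g k = 0)
    (halpha_ge0 : forall (k : elt M) (g : face M), g \in faces M k ->
       0 <= alpha g k)
    (halpha_sum : forall k : elt M, \sum_(g in faces M k) alpha g k = 1)
    (halpha_gt0 : forall (k : elt M) (g : face M), g \in faces M k ->
       is_interior (kind g) || is_dirichlet (kind g) -> 0 < alpha g k)
    (hS1 : forall (g : face M) (k v : elt M), is_interior (kind g) ->
       k != v -> g \in faces M k -> g \in faces M v ->
       Sigma1 S g k = delta1 O alpha g k v *: Bmx O g /\
       Sigma1 S g v = delta1 O alpha g k v *: Bmx O g)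
    (hSD : forall (g : face M) (k : elt M), is_dirichlet (kind g) ->
       g \in faces M k -> SigmaD S g = deltaD O alpha g k *: Bmx O g)
    (u : forall k : elt M, 'cV[R]_(nn O k)) :
  \sum_k wdot (hw O k) (u k)
    (semidiscrete_rhs S (fun=> 0) (fun=> 0) (fun=> 0) u k) <= 0.
Proof.
under eq_bigr do rewrite /wdot energy_rateE.
rewrite big_split /= sumrN addrC subr_le0.
have -> : \sum_k dissipation (u k) =
    \sum_k \sum_(g in faces M k) alpha g k * dissipation (u k).
  by apply: eq_bigr => k _; rewrite -mulr_suml halpha_sum mul1r.
(* Both double sums are reordered by face, because on an interior face only the sum of the two rates
   is controlled, not each one. *)
rewrite (exchange_big_dep xpredT)//= [X in _ <= X](exchange_big_dep xpredT)//=.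
apply: ler_sum => g _.
case E : (kind g).
- have gI : is_interior (kind g) by rewrite E.
  have [k [v [kv gk gv sumE]]] := sum_interior_face gI.
  rewrite !sumE; have [s1k s1v] := hS1 _ _ _ gI kv gk gv.
  have ak : 0 < alpha g k by rewrite halpha_gt0// gI.
  have av : 0 < alpha g v by rewrite halpha_gt0// gI.
  apply: face_rate_interior_le => // l gl.
  by split; [exact: hS3|exact: hS2|exact: hS4].
- have gD : is_dirichlet (kind g) by rewrite E.
  apply: ler_sum => k gk; apply: face_rate_dirichlet_le => //.
    by rewrite halpha_gt0// gD orbT.
  exact: hSD.
- apply: ler_sum => k gk; rewrite face_rate_neumann ?E//.
  by rewrite mulr_ge0 ?halpha_ge0// dissipation_ge0.
Qed.

(** * Regularity in time and monotonicity of the energy *)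

Lemma is_derive_bigsum (R : realType) (I : Type) (r : seq I)
    (f : I -> R -> R) (df : I -> R) (t : R) :
  (forall i, is_derive t (1 : R) (f i) (df i)) ->
  is_derive t (1 : R) (fun s => \sum_(i <- r) f i s) (\sum_(i <- r) df i).
Proof.
move=> dfP; elim: r => [|i r IH].
  under eq_fun do rewrite big_nil; rewrite big_nil; exact: is_derive_cst.
under eq_fun do rewrite big_cons; rewrite big_cons; exact: is_deriveD.
Qed.

(** The source is any topological space, so that it can be a closed time interval with its subspace
    topology. *)
Lemma continuous_bigsum (R : realType) (T : topologicalType) (I : Type)
    (r : seq I) (f : I -> T -> R) :
  (forall i, continuous (f i)) -> continuous (fun s => \sum_(i <- r) f i s).
Proof.
move=> fc; elim: r => [|i r IH] t.
  under eq_fun do rewrite big_nil; exact: cvg_cst.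
under eq_fun do rewrite big_cons; apply: continuousD; [exact: fc|exact: IH].
Qed.

Lemma wdot_derive (R : realType) (n : nat) (w : 'rV[R]_n) (x : R -> 'cV[R]_n)
    (dx : 'cV[R]_n) (t : R) :
  is_derive t (1 : R) x dx ->
  is_derive t (1 : R) (fun s => wdot w (x s) (x s)) (2 * wdot w (x t) dx).
Proof.
move=> xdx; rewrite wdotE mulr_sumr.
under eq_fun do rewrite wdotE.
apply: is_derive_bigsum => a.
have [dx1 dx2] := xdx.
have dxa : is_derive t (1 : R) (fun s => x s a 0) (dx a 0).
  split; first exact: ((derivable_mxP _ _ _).1 dx1).
  by rewrite -dx2 derive_mx// mxE.
apply: is_derive_eq.
rewrite /GRing.scale /=; ring.
Qed.

Lemma wdot_continuous (R : realType) (n : nat) (w : 'rV[R]_n)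
    (T : topologicalType) (x : T -> 'cV[R]_n) :
  continuous x -> continuous (fun s => wdot w (x s) (x s)).
Proof.
move=> xc; under eq_fun do rewrite wdotE.
apply: continuous_bigsum => a t.
have xa : {for t, continuous (fun s => x s a 0)}.
  apply: (@continuous_comp _ _ _ x (fun y : 'cV[R]_n => y a 0)).
    exact: xc.
  exact: coord_continuous.
by apply: cvgM; [exact: cvg_cst|apply: cvgM; exact: xa].
Qed.

Unset Implicit Arguments.

Theorem theorem3 (R : realType) (dom : domain R) (M : mesh dom) (p : nat)
    (O : sbp M p) (S : penalties O) (alpha : face M -> elt M -> R)
    (hS3 : forall (k : elt M) (g : face M), g \in faces M k ->
       is_interior (kind g) -> Sigma3 S g k = 2^-1 *: Bmx O g)
    (hS2 : forall (k : elt M) (g : face M), g \in faces M k ->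
       is_interior (kind g) -> - Sigma2 S g k = 2^-1 *: Bmx O g)
    (hS4 : forall (k : elt M) (g : face M), g \in faces M k ->
       is_interior (kind g) -> Sigma4 S g k = 0)
    (halpha_ge0 : forall (k : elt M) (g : face M), g \in faces M k ->
       0 <= alpha g k)
    (halpha_sum : forall k : elt M, \sum_(g in faces M k) alpha g k = 1)
    (halpha_gt0 : forall (k : elt M) (g : face M), g \in faces M k ->
       is_interior (kind g) || is_dirichlet (kind g) -> 0 < alpha g k)
    (hS1 : forall (g : face M) (k v : elt M), is_interior (kind g) ->
       k != v -> g \in faces M k -> g \in faces M v ->
       Sigma1 S g k = delta1 O alpha g k v *: Bmx O g /\
       Sigma1 S g v = delta1 O alpha g k v *: Bmx O g)
    (hSD : forall (g : face M) (k : elt M), is_dirichlet (kind g) ->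
       g \in faces M k -> SigmaD S g = deltaD O alpha g k *: Bmx O g) :
  energy_stable S.
Proof.
move=> J w sol s t sJ tJ st.
have stJ x : x \in `[s, t] -> x \in J.
  by rewrite in_itv /=; exact: (@interval_is_interval R J s t sJ tJ x).
(* The equation is assumed only in the interior of [J], which contains []s, t[] as an open subset of
   [J]. *)
have st_int x : x \in `]s, t[ -> ([set` J]°)%classic x.
  have /(_ x) : (`]s, t[ `<=` [set` J]°)%classic.
    rewrite -open_subsetE; last exact: itv_open.
    by move=> y /= yst; apply: stJ; exact: subset_itv_oo_cc yst.
  by apply.
have dE x : x \in `]s, t[ -> is_derive x (1 : R) (fun r => energy (w r))
    (\sum_k 2 * wdot (hw O k) (w x k)
       (semidiscrete_rhs S (fun=> 0) (fun=> 0) (fun=> 0) (w x) k)).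
  move=> xst; apply: is_derive_bigsum => k; apply: wdot_derive.
  by have [_] := sol k; apply; exact: st_int.
have cE : {within `[s, t], continuous (fun r => energy (w r))}%classic.
  apply: (@continuous_bigsum R (subspace `[s, t]%classic) _ _
    (fun k r => wdot (hw O k) (w r k) (w r k))) => k.
  apply: (@wdot_continuous R _ _ (subspace `[s, t]%classic) (fun r => w r k)).
  have [+ _] := sol k; apply: continuous_subspaceW => x; exact: stJ.
(* A nonpositive derivative on the open interval and continuity on the closed one give monotonicity
   up to [s] and [t], even if these are end points of [J]. *)
apply: (@ler0_derive1_le_cc R _ s t _ _ cE) => //.
- by move=> x /dE [].
- move=> x /dE [_ dx]; rewrite derive1E dx -mulr_sumr.
  by rewrite pmulr_rle0// (energy_rate_le0 hS3 hS2 hS4 halpha_ge0 halpha_sum).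
- by rewrite in_itv /= st lexx.
- by rewrite in_itv /= lexx st.
Qed.
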